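(* Let $m,n$ be positive integers, let $\mathrm{U}(\mathfrak{gl}(m|n))$ be the universal enveloping algebra of the complex Lie superalgebra $\mathfrak{gl}(m|n)$ with standard basis $E_{ij}$, let $\widehat E$ be the $(m+n)\times(m+n)$ matrix with entries $\widehat E_{ij}=(-1)^{\bar\jmath}E_{ij}$, and let $\widehat E^{(k)}$ denote the submatrix of $\widehat E$ formed by its first $k$ rows and columns. Let $B(t)$ be the quantum Berezinian $$ \begin{aligned} B(t)=\sum_{\sigma\in S_m}\operatorname{sgn}\sigma\;& \big(1+t\,\widehat E\big)_{\sigma(1),1}\cdots \big(1+t(\widehat E-m+1)\big)_{\sigma(m),m}\\ \times\sum_{\tau\in S_n}\operatorname{sgn}\tau\;& \big(1+t(\widehat E-m+1)\big)^{-1}_{m+1,m+\tau(1)}\cdots \big(1+t(\widehat E-m+n)\big)^{-1}_{m+n,m+\tau(n)} . \end{aligned} $$ Then, in the algebra $\mathrm{U}(\mathfrak{gl}(m|n))[[t]]$ of formal power series in $t$ with coefficients in $\mathrm{U}(\mathfrak{gl}(m|n))$, we have $$ \begin{aligned} B(t)={}&\big|1+t\,\widehat E^{(1)}\big|_{11}\cdots \big|1+t(\widehat E^{(m)}-m+1)\big|_{mm}\\ &\times\big|1+t(\widehat E^{(m+1)}-m+1)\big|^{-1}_{m+1,m+1}\cdots \big|1+t(\widehat E^{(m+n)}-m+n)\big|^{-1}_{m+n,m+n}, \end{aligned} $$ where the $i$-th factor for $1\le i\le m$ is $\big|1+t(\widehat E^{(i)}-i+1)\big|_{ii}$, the $(m+j)$-th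 factor for $1\le j\le n$ is $\big|1+t(\widehat E^{(m+j)}-m+j)\big|^{-1}_{m+j,m+j}$, and $|\cdot|_{ii}$ denotes a quasideterminant. Moreover, the $m+n$ factors in this decomposition commute pairwise in $\mathrm{U}(\mathfrak{gl}(m|n))[[t]]$.
   Context: **The Lie superalgebra.** For $i\in\{1,\dots,m+n\}$ let $\bar\imath\in\mathbb{Z}_2$ be $0$ if $i\le m$ and $1$ if $i>m$. The Lie superalgebra $\mathfrak{gl}(m|n)$ over $\mathbb{C}$ has basis $E_{ij}$, $1\le i,j\le m+n$, where $E_{ij}$ has parity $\bar\imath+\bar\jmath$, and (super)commutation relations $$[E_{ij},E_{kl}]=\delta_{kj}E_{il}-\delta_{il}E_{kj}(-1)^{(\bar\imath+\bar\jmath)(\bar k+\bar l)}.$$ **Matrix conventions.** Matrices have entries in $\mathrm{U}(\mathfrak{gl}(m|n))[[t]]$ and are multiplied in the usual way, $(XY)_{ij}=\sum_k X_{ik}Y_{kj}$, with no extra signs. A scalar in a matrix expression means that scalar times the identity matrix, e.g. $1+t(\widehat E-c)=I+t(\widehat E-cI)$. A matrix of the form $1+tA$ is inverted as a formal power series in $t$. The notation $(X)^{-1}_{ij}$ means the $ij$-th entry of the inverse matrix $X^{-1}$. In $B(t)$, the $a$-th factor in the first sum is $\big(1+t(\widehat E-a+1)\big)_{\sigma(a),a}$ for $a=1,\dots,m$, and the $b$-th factor in the second sum is $\big(1+t(\widehat E-m+b)\big)^{-1}_{m+b,m+\tau(b)}$ for $b=1,\dots,n$; the products are taken in the written order (index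 increasing from left to right). **Quasideterminants.** If $X$ is an invertible square matrix over a unital ring such that the $ji$-th entry $(X^{-1})_{ji}$ of $X^{-1}$ is invertible in the ring, the $ij$-th quasideterminant of $X$ is $|X|_{ij}=\big((X^{-1})_{ji}\big)^{-1}$. The notation $|X|_{ij}^{-1}$ means the inverse of the ring element $|X|_{ij}$. *)

(* Defs.v *)
From HB Require Import structures.
From mathcomp Require Import all_boot all_order all_fingroup all_algebra.
From mathcomp Require Import generic_quotient.
From mathcomp Require Import boolp classical_sets reals.
From mathcomp Require Import complex.
From mathcomp Require Import ring.

Set Implicit Arguments.
Unset Strict Implicit.
Unset Printing Implicit Defensive.

Import GRing.Theory.
Local Open Scope ring_scope.
Local Open Scope quotient_scope.

(* Lie superalgebras; the parities 0 and 1 are represented by [false] and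
   [true], so that [(+)] and [&&] are the addition and product of Z/2. *)

Record lieSuperalgebra (K : fieldType) := LieSuperalgebra {
  lsa_sort :> lmodType K;
  lsa_homog : bool -> lsa_sort -> Prop;
  lsa_bracket : lsa_sort -> lsa_sort -> lsa_sort;
  _ : forall p, lsa_homog p 0;
  _ : forall p a x y,
        lsa_homog p x -> lsa_homog p y -> lsa_homog p (a *: x + y);
  _ : forall x, exists y z, [/\ lsa_homog false y, lsa_homog true z & x = y + z];
  _ : forall x, lsa_homog false x -> lsa_homog true x -> x = 0;
  _ : forall z a x y,
        lsa_bracket (a *: x + y) z = a *: lsa_bracket x z + lsa_bracket y z;
  _ : forall z a x y,
        lsa_bracket z (a *: x + y) = a *: lsa_bracket z x + lsa_bracket z y;
  _ : forall p q x y, lsa_homog p x -> lsa_homog q y ->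
        lsa_homog (p (+) q) (lsa_bracket x y);
  _ : forall p q x y, lsa_homog p x -> lsa_homog q y ->
        lsa_bracket x y = - ((-1) ^+ (p && q) *: lsa_bracket y x);
  _ : forall p q r x y z,
        lsa_homog p x -> lsa_homog q y -> lsa_homog r z ->
        lsa_bracket x (lsa_bracket y z) =
          lsa_bracket (lsa_bracket x y) z
          + (-1) ^+ (p && q) *: lsa_bracket y (lsa_bracket x z)
}.

(* The universal enveloping algebra U(g): the unital associative K-algebra
   generated by the vector space g subject to
   x y - (-1)^(|x||y|) y x = [x, y] for homogeneous x and y, constructed as
   the quotient of formal expressions by the congruence [uea_rel]. *)

Section EnvelopingAlgebra.
Variables (K : fieldType) (g : lieSuperalgebra K).

Inductive uea_term : Type :=
| UConst of K
| UGen of g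
| UAdd of uea_term & uea_term
| UMul of uea_term & uea_term.

Inductive uea_rel : uea_term -> uea_term -> Prop :=
| URefl x : uea_rel x x
| USym x y : uea_rel x y -> uea_rel y x
| UTrans x y z : uea_rel x y -> uea_rel y z -> uea_rel x z
| UAddCongr x x' y y' :
    uea_rel x x' -> uea_rel y y' -> uea_rel (UAdd x y) (UAdd x' y')
| UMulCongr x x' y y' :
    uea_rel x x' -> uea_rel y y' -> uea_rel (UMul x y) (UMul x' y')
| UAddA x y z : uea_rel (UAdd x (UAdd y z)) (UAdd (UAdd x y) z)
| UAddC x y : uea_rel (UAdd x y) (UAdd y x)
| UAdd0 x : uea_rel (UAdd (UConst 0) x) x
| UAddN x : uea_rel (UAdd (UMul (UConst (-1)) x) x) (UConst 0)
| UMulA x y z : uea_rel (UMul x (UMul y z)) (UMul (UMul x y) z)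
| UMul1l x : uea_rel (UMul (UConst 1) x) x
| UMul1r x : uea_rel (UMul x (UConst 1)) x
| UMulDl x y z : uea_rel (UMul (UAdd x y) z) (UAdd (UMul x z) (UMul y z))
| UMulDr x y z : uea_rel (UMul x (UAdd y z)) (UAdd (UMul x y) (UMul x z))
| UConstD a b : uea_rel (UConst (a + b)) (UAdd (UConst a) (UConst b))
| UConstM a b : uea_rel (UConst (a * b)) (UMul (UConst a) (UConst b))
| UConstC a x : uea_rel (UMul (UConst a) x) (UMul x (UConst a))
| UGenD u v : uea_rel (UGen (u + v)) (UAdd (UGen u) (UGen v))
| UGenZ a u : uea_rel (UGen (a *: u)) (UMul (UConst a) (UGen u))
| UGenBracket p q u v : lsa_homog p u -> lsa_homog q v ->
    uea_rel (UMul (UGen u) (UGen v))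
      (UAdd (UMul (UConst ((-1) ^+ (p && q))) (UMul (UGen v) (UGen u)))
            (UGen (lsa_bracket u v))).

HB.instance Definition _ := gen_eqMixin uea_term.
HB.instance Definition _ := gen_choiceMixin uea_term.

Definition uea_relb (x y : uea_term) : bool := `[< uea_rel x y >].

Lemma uea_relb_refl : reflexive uea_relb.
Proof. by move=> x; apply/asboolP/URefl. Qed.

Lemma uea_relb_sym : symmetric uea_relb.
Proof. by move=> x y; apply/asboolP/asboolP => /USym. Qed.

Lemma uea_relb_trans : transitive uea_relb.
Proof.
by move=> y x z /asboolP xy /asboolP yz; apply/asboolP/(UTrans xy yz).
Qed.

Canonical uea_equiv :=
  EquivRel uea_relb uea_relb_refl uea_relb_sym uea_relb_trans.

Definition uea : Type := {eq_quot uea_equiv}.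
HB.instance Definition _ := Choice.on uea.
HB.instance Definition _ := EqQuotient.on uea.

Definition uea_class (x : uea_term) : uea := \pi_uea x.

Lemma uea_classP x y : uea_rel x y -> uea_class x = uea_class y.
Proof. by move=> xy; apply/eqP; rewrite eqmodE; apply/asboolP. Qed.

Lemma uea_class_inj x y : uea_class x = uea_class y -> uea_rel x y.
Proof. by move=> /eqP; rewrite eqmodE => /asboolP. Qed.

Lemma uea_classK (x : uea) : uea_class (repr x) = x.
Proof. exact: reprK. Qed.

Definition uea_const (a : K) : uea := uea_class (UConst a).
Definition uea_gen (u : g) : uea := uea_class (UGen u).
Definition uea_add (x y : uea) : uea := uea_class (UAdd (repr x) (repr y)).
Definition uea_mul (x y : uea) : uea := uea_class (UMul (repr x) (repr y)).
Definition uea_opp (x : uea) : uea := uea_mul (uea_const (-1)) x.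
Definition uea_scale (a : K) (x : uea) : uea := uea_mul (uea_const a) x.

Lemma uea_addE x y : uea_add (uea_class x) (uea_class y) = uea_class (UAdd x y).
Proof. by apply: uea_classP; apply: UAddCongr; apply: uea_class_inj; rewrite uea_classK. Qed.

Lemma uea_mulE x y : uea_mul (uea_class x) (uea_class y) = uea_class (UMul x y).
Proof. by apply: uea_classP; apply: UMulCongr; apply: uea_class_inj; rewrite uea_classK. Qed.

Ltac uea_lift :=
  repeat (let x := fresh "x" in move=> x);
  repeat match goal with
  | x : uea |- _ => rewrite -(uea_classK x); move: (repr x) => {}x
  end;
  rewrite /uea_opp /uea_scale /uea_const /uea_gen ?(uea_addE, uea_mulE);
  apply: uea_classP.

Fact uea_addA : associative uea_add. Proof. uea_lift; exact: UAddA. Qed.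
Fact uea_addC : commutative uea_add. Proof. uea_lift; exact: UAddC. Qed.
Fact uea_add0 : left_id (uea_const 0) uea_add.
Proof. uea_lift; exact: UAdd0. Qed.
Fact uea_addN : left_inverse (uea_const 0) uea_opp uea_add.
Proof. uea_lift; exact: UAddN. Qed.

HB.instance Definition _ :=
  GRing.isZmodule.Build uea uea_addA uea_addC uea_add0 uea_addN.

Fact uea_mulA : associative uea_mul. Proof. uea_lift; exact: UMulA. Qed.
Fact uea_mul1 : left_id (uea_const 1) uea_mul.
Proof. uea_lift; exact: UMul1l. Qed.
Fact uea_mulr1 : right_id (uea_const 1) uea_mul.
Proof. uea_lift; exact: UMul1r. Qed.
Fact uea_mulDl : left_distributive uea_mul uea_add.
Proof. uea_lift; exact: UMulDl. Qed.
Fact uea_mulDr : right_distributive uea_mul uea_add.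
Proof. uea_lift; exact: UMulDr. Qed.

Section Eval.
Variables (A : nzRingType) (phi : K -> A) (f : g -> A).

Fixpoint uea_term_eval (x : uea_term) : A :=
  match x with
  | UConst a => phi a
  | UGen u => f u
  | UAdd x y => uea_term_eval x + uea_term_eval y
  | UMul x y => uea_term_eval x * uea_term_eval y
  end.

Hypothesis phiD : {morph phi : a b / a + b}.
Hypothesis phiM : {morph phi : a b / a * b}.
Hypothesis phi1 : phi 1 = 1.
Hypothesis phiC : forall a y, phi a * y = y * phi a.
Hypothesis fD : {morph f : u v / u + v}.
Hypothesis fZ : forall a u, f (a *: u) = phi a * f u.
Hypothesis fB : forall p q u v, lsa_homog p u -> lsa_homog q v ->
  f u * f v = phi ((-1) ^+ (p && q)) * (f v * f u) + f (lsa_bracket u v).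

Lemma uea_term_evalP x y :
  uea_rel x y -> uea_term_eval x = uea_term_eval y.
Proof.
have phi0 : phi 0 = 0 by apply: (addrI (phi 0)); rewrite -phiD !addr0.
elim=> {x y} //=.
- by move=> x y z _ -> _ ->.
- by move=> x x' y y' _ -> _ ->.
- by move=> x x' y y' _ -> _ ->.
- by move=> *; rewrite addrA.
- by move=> *; rewrite addrC.
- by move=> *; rewrite phi0 add0r.
- move=> x; rewrite -[X in _ + X]mul1r -mulrDl -phi1 -phiD addNr phi0 mul0r.
  by [].
- by move=> *; rewrite mulrA.
- by move=> *; rewrite phi1 mul1r.
- by move=> *; rewrite phi1 mulr1.
- by move=> *; rewrite mulrDl.
- by move=> *; rewrite mulrDr.
Qed.

End Eval.

Fact uea_oner_neq0 : uea_const 1 != 0 :> uea.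
Proof.
apply/eqP => /uea_class_inj.
move=> /(@uea_term_evalP K id (fun=> 0)) /= H.
suff /eqP : (1 : K) = 0 by rewrite oner_eq0.
apply: H => //.
- by move=> *; rewrite mulrC.
- by move=> *; rewrite addr0.
- by move=> *; rewrite mulr0.
- by move=> *; rewrite !mulr0 addr0.
Qed.

HB.instance Definition _ := GRing.Zmodule_isNzRing.Build uea
  uea_mulA uea_mul1 uea_mulr1 uea_mulDl uea_mulDr uea_oner_neq0.

Lemma uea_constD : {morph uea_const : a b / a + b}.
Proof. by move=> a b; rewrite [RHS]uea_addE; apply/uea_classP/UConstD. Qed.

Lemma uea_constM : {morph uea_const : a b / a * b}.
Proof. by move=> a b; rewrite [RHS]uea_mulE; apply/uea_classP/UConstM. Qed.

Lemma uea_constC a (x : uea) : uea_const a * x = x * uea_const a.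
Proof. rewrite -(uea_classK x) [LHS]uea_mulE [RHS]uea_mulE; exact/uea_classP/UConstC. Qed.

Fact uea_scaleA a b (x : uea) :
  uea_scale a (uea_scale b x) = uea_scale (a * b) x.
Proof. by rewrite /uea_scale uea_constM; apply: uea_mulA. Qed.
Fact uea_scale1 : left_id 1 uea_scale. Proof. exact: uea_mul1. Qed.
Fact uea_scaleDr : right_distributive uea_scale +%R.
Proof. by move=> a x y; apply: uea_mulDr. Qed.
Fact uea_scaleDl (x : uea) : {morph uea_scale^~ x : a b / a + b}.
Proof. by move=> a b; rewrite /uea_scale uea_constD; apply: uea_mulDl. Qed.

HB.instance Definition _ := GRing.Zmodule_isLmodule.Build K uea
  uea_scaleA uea_scale1 uea_scaleDr uea_scaleDl.

Fact uea_scaleAl a (x y : uea) : a *: (x * y) = a *: x * y.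
Proof. exact: uea_mulA. Qed.
HB.instance Definition _ := GRing.Lmodule_isLalgebra.Build K uea uea_scaleAl.

Fact uea_scaleAr a (x y : uea) : a *: (x * y) = x * (a *: y).
Proof.
rewrite -[a *: (x * y)]/(uea_const a * (x * y)).
by rewrite -[a *: y]/(uea_const a * y) mulrA uea_constC mulrA.
Qed.
HB.instance Definition _ := GRing.Lalgebra_isAlgebra.Build K uea uea_scaleAr.

Lemma uea_constE a : uea_const a = a *: 1.
Proof. by rewrite -[RHS]/(uea_const a * 1) mulr1. Qed.

Fact uea_gen_is_linear : linear uea_gen.
Proof.
move=> a u v; rewrite -[a *: uea_gen u]/(uea_mul (uea_const a) (uea_gen u)).
rewrite [uea_mul _ _]uea_mulE [RHS]uea_addE; apply: uea_classP.
by apply: (UTrans (UGenD _ _)); apply: UAddCongr; [apply: UGenZ | apply: URefl].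
Qed.
HB.instance Definition _ := GRing.isLinear.Build K g uea _ uea_gen uea_gen_is_linear.

Lemma uea_classD t s : uea_class (UAdd t s) = uea_class t + uea_class s.
Proof. by rewrite -uea_addE. Qed.
Lemma uea_classM t s : uea_class (UMul t s) = uea_class t * uea_class s.
Proof. by rewrite -uea_mulE. Qed.
Lemma uea_classZ a t : uea_class (UMul (UConst a) t) = a *: uea_class t.
Proof. by rewrite -uea_mulE. Qed.

Lemma uea_genM p q u v : lsa_homog p u -> lsa_homog q v ->
  uea_gen u * uea_gen v - (-1) ^+ (p && q) *: (uea_gen v * uea_gen u) =
  uea_gen (lsa_bracket u v).
Proof.
move=> pu qv; apply/eqP; rewrite subr_eq addrC; apply/eqP.
rewrite /uea_gen -!uea_classM -uea_classZ -uea_classD.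
exact/uea_classP/UGenBracket.
Qed.

(* The universal property of U(g). *)
Theorem uea_universal (A : algType K) (f : {linear g -> A}) :
  (forall p q u v, lsa_homog p u -> lsa_homog q v ->
     f u * f v - (-1) ^+ (p && q) *: (f v * f u) = f (lsa_bracket u v)) ->
  exists2 h : {lrmorphism uea -> A}, forall u, h (uea_gen u) = f u
    & forall h' : {lrmorphism uea -> A},
        (forall u, h' (uea_gen u) = f u) -> h' =1 h.
Proof.
move=> fB; pose ev := uea_term_eval (fun a => a%:A : A) f.
have evP x y : uea_rel x y -> ev x = ev y.
  apply: uea_term_evalP => [a b|a b||a z|u v|a u|p q u v pu qv].
  - by rewrite scalerDl.
  - by rewrite -scalerAl mul1r scalerA.
  - by rewrite scale1r.
  - by rewrite -scalerAl -scalerAr mul1r mulr1.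
  - by rewrite raddfD.
  - by rewrite linearZ /= -scalerAl mul1r.
  - by rewrite -(fB _ _ _ _ pu qv) -scalerAl mul1r addrC subrK.
pose h (x : uea) := ev (repr x).
have hE t : h (uea_class t) = ev t.
  by apply: evP; apply: uea_class_inj; rewrite uea_classK.
have hlin : linear h.
  move=> a x y; rewrite -(uea_classK x) -(uea_classK y).
  by rewrite -uea_classZ -uea_classD !hE /= -scalerAl mul1r.
have hmul : monoid_morphism h.
  split=> [|x y]; first by rewrite -[1]/(uea_class _) hE /= scale1r.
  by rewrite -(uea_classK x) -(uea_classK y) -uea_classM !hE.
pose hl := GRing.isLinear.Build _ _ _ _ h hlin.
pose hm := GRing.isMonoidMorphism.Build _ _ h hmul.
pose H : {lrmorphism uea -> A} := HB.pack h hl hm.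
exists H => [u|h' h'E x]; first exact: hE.
rewrite -(uea_classK x) /= hE; elim: (repr x) => [a|u|t IHt s IHs|t IHt s IHs].
- by rewrite -[uea_class _]/(uea_const a) uea_constE linearZ rmorph1.
- exact: h'E.
- by rewrite uea_classD raddfD /= IHt IHs.
- by rewrite uea_classM rmorphM /= IHt IHs.
Qed.

End EnvelopingAlgebra.

(* The Lie superalgebra gl(m|n): square matrices of size m + n, with E_ij the
   matrix unit. Indices start at 0, so the odd ones are those >= m. *)

Section GeneralLinear.
Variables (K : fieldType) (m n : nat).
Local Notation gl_mx := 'M[K]_(m + n).
Local Notation idx := 'I_(m + n).

Definition gl_parity (i : idx) : bool := (m <= i)%N.

Definition gl_homog (p : bool) (X : gl_mx) : Prop :=
  forall i j, X i j != 0 -> gl_parity i (+) gl_parity j = p.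

Definition gl_bracket_unit (i j k l : idx) : gl_mx :=
  (k == j)%:R *: delta_mx i l -
  ((i == l)%:R * (-1) ^+ ((gl_parity i (+) gl_parity j) &&
                          (gl_parity k (+) gl_parity l))) *: delta_mx k j.

Definition gl_bracket (X Y : gl_mx) : gl_mx :=
  \sum_i \sum_j \sum_k \sum_l (X i j * Y k l) *: gl_bracket_unit i j k l.

Lemma gl_bracket_delta i j k l :
  gl_bracket (delta_mx i j) (delta_mx k l) = gl_bracket_unit i j k l.
Proof.
rewrite /gl_bracket (bigD1 i) //= (bigD1 j) //= (bigD1 k) //= (bigD1 l) //=.
rewrite !mxE !eqxx mulr1 scale1r.
rewrite big1 => [|l' /negPf ll]; last by rewrite !mxE ll andbF mulr0 scale0r.
rewrite big1 => [|k' /negPf kk]; last first.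
  by rewrite big1 // => l' _; rewrite !mxE kk mulr0 scale0r.
rewrite big1 => [|j' /negPf jj]; last first.
  by rewrite !big1 // => k' _; rewrite big1 // => l' _; rewrite !mxE jj andbF mul0r scale0r.
rewrite big1 => [|i' /negPf ii]; last first.
  rewrite !big1 // => j' _; rewrite big1 // => k' _; rewrite big1 // => l' _.
  by rewrite !mxE ii mul0r scale0r.
by rewrite !addr0.
Qed.

Lemma gl_bracketE p q X Y : gl_homog p X -> gl_homog q Y ->
  gl_bracket X Y = X *m Y - (-1) ^+ (p && q) *: (Y *m X).
Proof.
move=> pX qY.
transitivity (\sum_i \sum_j \sum_k \sum_l (X i j * Y k l) *:
   (delta_mx i j *m delta_mx k l -
    (-1) ^+ (p && q) *: (delta_mx k l *m delta_mx i j) : gl_mx)).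
  apply: eq_bigr => i _; apply: eq_bigr => j _.
  apply: eq_bigr => k _; apply: eq_bigr => l _.
  have [->|/pX <-] := eqVneq (X i j) 0; first by rewrite mul0r !scale0r.
  have [->|/qY <-] := eqVneq (Y k l) 0; first by rewrite mulr0 !scale0r.
  rewrite /gl_bracket_unit !mul_delta_mx_cond eq_sym -!scaler_nat scalerA.
  by rewrite [_%:R * _]mulrC [i == l]eq_sym.
have XY : X *m Y = \sum_i \sum_j \sum_k \sum_l
    (X i j * Y k l) *: (delta_mx i j *m delta_mx k l).
  rewrite {1}[X]matrix_sum_delta mulmx_suml; apply: eq_bigr => i _.
  rewrite mulmx_suml; apply: eq_bigr => j _.
  rewrite {1}[Y]matrix_sum_delta mulmx_sumr; apply: eq_bigr => k _.
  rewrite mulmx_sumr; apply: eq_bigr => l _.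
  by rewrite -scalemxAl -scalemxAr scalerA.
have YX : Y *m X = \sum_i \sum_j \sum_k \sum_l
    (X i j * Y k l) *: (delta_mx k l *m delta_mx i j).
  rewrite {1}[X]matrix_sum_delta mulmx_sumr; apply: eq_bigr => i _.
  rewrite mulmx_sumr; apply: eq_bigr => j _.
  rewrite {1}[Y]matrix_sum_delta mulmx_suml; apply: eq_bigr => k _.
  rewrite mulmx_suml; apply: eq_bigr => l _.
  by rewrite -scalemxAl -scalemxAr scalerA mulrC.
rewrite XY YX; do 4!(rewrite scaler_sumr -sumrB; apply: eq_bigr => ? _).
by rewrite scalerBr !scalerA [_ * (-1) ^+ _]mulrC.
Qed.

Lemma gl_homog_delta i j :
  gl_homog (gl_parity i (+) gl_parity j) (delta_mx i j).
Proof.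
move=> a b; rewrite mxE.
by have [->|_] := eqVneq a i; have [->|_] := eqVneq b j; rewrite ?eqxx.
Qed.

Lemma gl_homog0 p : gl_homog p 0.
Proof. by move=> i j; rewrite mxE eqxx. Qed.

Lemma gl_homog_lin p a X Y :
  gl_homog p X -> gl_homog p Y -> gl_homog p (a *: X + Y).
Proof.
move=> pX pY i j; rewrite !mxE.
have [->|/pX //] := eqVneq (X i j) 0; rewrite mulr0 add0r; exact: pY.
Qed.

Lemma gl_homog_decomp X :
  exists Y Z, [/\ gl_homog false Y, gl_homog true Z & X = Y + Z].
Proof.
exists (\matrix_(i, j) if gl_parity i (+) gl_parity j then 0 else X i j).
exists (\matrix_(i, j) if gl_parity i (+) gl_parity j then X i j else 0).
split=> [i j|i j|]; [| |apply/matrixP => i j]; rewrite !mxE;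
  by case: (_ (+) _); rewrite ?eqxx ?add0r ?addr0.
Qed.

Lemma gl_homog_direct X : gl_homog false X -> gl_homog true X -> X = 0.
Proof.
move=> X0 X1; apply/matrixP => i j; rewrite mxE.
have [//|x0] := eqVneq (X i j) 0.
by move: (X0 _ _ x0) (X1 _ _ x0) => ->.
Qed.

Lemma gl_bracketl Z a X Y :
  gl_bracket (a *: X + Y) Z = a *: gl_bracket X Z + gl_bracket Y Z.
Proof.
do 4!(rewrite scaler_sumr -big_split; apply: eq_bigr => ? _).
by rewrite !mxE mulrDl scalerDl -mulrA scalerA.
Qed.

Lemma gl_bracketr Z a X Y :
  gl_bracket Z (a *: X + Y) = a *: gl_bracket Z X + gl_bracket Z Y.
Proof.
do 4!(rewrite scaler_sumr -big_split; apply: eq_bigr => ? _).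
by rewrite !mxE mulrDr scalerDl mulrCA scalerA.
Qed.

Lemma gl_homogM p q X Y :
  gl_homog p X -> gl_homog q Y -> gl_homog (p (+) q) (X *m Y).
Proof.
move=> pX qY i j; rewrite mxE; apply: contraNeq => pq; rewrite big1 // => k _.
have [->|/pX Xp] := eqVneq (X i k) 0; first by rewrite mul0r.
have [->|/qY Yq] := eqVneq (Y k j) 0; first by rewrite mulr0.
move: pq; rewrite -Xp -Yq.
by case: (gl_parity i) (gl_parity j) (gl_parity k) => [] [] [].
Qed.

Lemma gl_homog_bracket p q X Y :
  gl_homog p X -> gl_homog q Y -> gl_homog (p (+) q) (gl_bracket X Y).
Proof.
move=> pX qY; rewrite (gl_bracketE pX qY) addrC -scaleNr.
by apply: gl_homog_lin; [rewrite addbC|]; apply: gl_homogM.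
Qed.

Lemma gl_bracket_skew p q X Y : gl_homog p X -> gl_homog q Y ->
  gl_bracket X Y = - ((-1) ^+ (p && q) *: gl_bracket Y X).
Proof.
move=> pX qY; rewrite (gl_bracketE pX qY) (gl_bracketE qY pX).
by rewrite [q && p]andbC scalerBr scalerA -signr_addb addbb scale1r opprB.
Qed.

Lemma gl_jacobi p q r X Y Z :
  gl_homog p X -> gl_homog q Y -> gl_homog r Z ->
  gl_bracket X (gl_bracket Y Z) =
    gl_bracket (gl_bracket X Y) Z
    + (-1) ^+ (p && q) *: gl_bracket Y (gl_bracket X Z).
Proof.
move=> pX qY rZ.
have YZ := gl_homog_bracket qY rZ.
have XY := gl_homog_bracket pX qY.
have XZ := gl_homog_bracket pX rZ.
rewrite (gl_bracketE pX YZ) (gl_bracketE XY rZ) (gl_bracketE qY XZ).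
rewrite (gl_bracketE pX qY) (gl_bracketE pX rZ) (gl_bracketE qY rZ).
rewrite !(mulmxBl, mulmxBr) -!(scalemxAl, scalemxAr) !mulmxA.
set a := X *m Y *m Z; set b := X *m Z *m Y; set c := Y *m Z *m X.
set d := Z *m Y *m X; set e := Y *m X *m Z; set f := Z *m X *m Y.
apply/matrixP => i j; rewrite !mxE.
by case: p q r {pX qY rZ YZ XY XZ} => [] [] []; rewrite /= ?expr0 ?expr1; ring.
Qed.

Definition gl : lieSuperalgebra K := LieSuperalgebra
  gl_homog0 gl_homog_lin gl_homog_decomp gl_homog_direct gl_bracketl
  gl_bracketr gl_homog_bracket gl_bracket_skew gl_jacobi.

End GeneralLinear.

(* Formal power series in one central variable over a noncommutative ring. *)

Record fps (A : Type) := FPS { fps_coef : nat -> A }.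

Lemma fpsP A (f g : fps A) : fps_coef f =1 fps_coef g -> f = g.
Proof. by case: f g => [f] [g] /= /funext ->. Qed.

HB.instance Definition _ A := gen_eqMixin (fps A).
HB.instance Definition _ A := gen_choiceMixin (fps A).

Section FormalPowerSeries.
Variable A : nzRingType.
Implicit Types f g h : fps A.
Local Notation "f .@ k" := (fps_coef f k) (at level 2, k at level 2).

Definition fps_zero : fps A := FPS (fun=> 0).
Definition fps_add f g : fps A := FPS (fun k => f.@k + g.@k).
Definition fps_opp f : fps A := FPS (fun k => - f.@k).

Fact fps_addA : associative fps_add.
Proof. by move=> f g h; apply: fpsP => k; apply: addrA. Qed.
Fact fps_addC : commutative fps_add.
Proof. by move=> f g; apply: fpsP => k; apply: addrC. Qed.
Fact fps_add0 : left_id fps_zero fps_add.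
Proof. by move=> f; apply: fpsP => k; apply: add0r. Qed.
Fact fps_addN : left_inverse fps_zero fps_opp fps_add.
Proof. by move=> f; apply: fpsP => k; apply: addNr. Qed.

HB.instance Definition _ :=
  GRing.isZmodule.Build (fps A) fps_addA fps_addC fps_add0 fps_addN.

Definition fpsC (a : A) : fps A := FPS (fun k => if k == 0%N then a else 0).
Definition fpsX : fps A := FPS (fun k => (k == 1%N)%:R).
Definition fps_mul f g : fps A :=
  FPS (fun k => \sum_(i < k.+1) f.@i * g.@(k - i)).

Lemma fps_coef_mul f g k :
  (fps_mul f g).@k = \sum_(i < k.+1) f.@i * g.@(k - i).
Proof. by []. Qed.

Lemma fps_coefMr f g k : (fps_mul f g).@k = \sum_(i < k.+1) f.@(k - i) * g.@i.
Proof.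
rewrite /= (reindex_inj rev_ord_inj) /=.
by apply: eq_bigr => i _; rewrite (sub_ordK i).
Qed.

Fact fps_mulA : associative fps_mul.
Proof.
move=> p q r; apply: fpsP => i; rewrite fps_coef_mul fps_coefMr.
pose coef3 j k := p.@j * (q.@(i - j - k) * r.@k).
transitivity (\sum_(j < i.+1) \sum_(k < i.+1 | (k <= i - j)%N) coef3 j k).
  apply: eq_bigr => j _; rewrite fps_coefMr big_distrr /=.
  by rewrite (big_ord_narrow_leq (leq_subr _ _)).
rewrite (exchange_big_dep predT) //=; apply: eq_bigr => k _.
transitivity (\sum_(j < i.+1 | (j <= i - k)%N) coef3 j k).
  apply: eq_bigl => j; rewrite -ltnS -(ltnS j) -!subSn ?leq_ord //.
  by rewrite -subn_gt0 -(subn_gt0 j) -!subnDA addnC.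
rewrite (big_ord_narrow_leq (leq_subr _ _)) big_distrl /=.
by apply: eq_bigr => j _; rewrite /coef3 -!subnDA addnC mulrA.
Qed.

Fact fps_mul1 : left_id (fpsC 1) fps_mul.
Proof.
move=> f; apply: fpsP => k /=; rewrite big_ord_recl /= subn0 mul1r big1 ?addr0//.
by move=> i _; rewrite mul0r.
Qed.
Fact fps_mulr1 : right_id (fpsC 1) fps_mul.
Proof.
move=> f; apply: fpsP => k; rewrite fps_coefMr big_ord_recl /= subn0 mulr1.
by rewrite big1 ?addr0 // => i _; rewrite mulr0.
Qed.
Fact fps_mulDl : left_distributive fps_mul fps_add.
Proof.
move=> f g h; apply: fpsP => k /=; rewrite -big_split.
by apply: eq_bigr => i _; rewrite mulrDl.
Qed.
Fact fps_mulDr : right_distributive fps_mul fps_add.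
Proof.
move=> f g h; apply: fpsP => k /=; rewrite -big_split.
by apply: eq_bigr => i _; rewrite mulrDr.
Qed.
Fact fps_oner_neq0 : fpsC 1 != 0.
Proof.
apply/eqP => /(congr1 (fun f => f.@0)) /= /eqP.
by rewrite oner_eq0.
Qed.

HB.instance Definition _ := GRing.Zmodule_isNzRing.Build (fps A)
  fps_mulA fps_mul1 fps_mulr1 fps_mulDl fps_mulDr fps_oner_neq0.

Lemma fps_coefD f g k : (f + g).@k = f.@k + g.@k. Proof. by []. Qed.
Lemma fps_coefN f k : (- f).@k = - f.@k. Proof. by []. Qed.
Lemma fps_coef0 k : (0 : fps A).@k = 0. Proof. by []. Qed.
Lemma fps_coef1 k : (1 : fps A).@k = (k == 0%N)%:R.
Proof. by case: k. Qed.
Lemma fps_coefM f g k : (f * g).@k = \sum_(i < k.+1) f.@i * g.@(k - i).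
Proof. by []. Qed.
Lemma fps_coef_sum I (r : seq I) (P : pred I) (F : I -> fps A) k :
  (\sum_(i <- r | P i) F i).@k = \sum_(i <- r | P i) (F i).@k.
Proof. by elim/big_rec2: _ => // i x y _ <-. Qed.

Lemma fps_coefXM f k : (fpsX * f).@k = if k is k'.+1 then f.@k' else 0.
Proof.
rewrite fps_coefM; case: k => [|k]; rewrite big_ord_recl /= mul0r add0r.
  by rewrite big_ord0.
rewrite big_ord_recl /= mul1r subSS subn0 big1 ?addr0 // => i _.
by rewrite mul0r.
Qed.

Lemma fps_coefCM a f k : (fpsC a * f).@k = a * f.@k.
Proof.
rewrite fps_coefM big_ord_recl /= subn0 big1 ?addr0 // => i _.
by rewrite mul0r.
Qed.

Lemma fps_coefMC a f k : (f * fpsC a).@k = f.@k * a.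
Proof.
rewrite [LHS]fps_coefMr big_ord_recl /= subn0 big1 ?addr0 // => i _.
by rewrite mulr0.
Qed.

Lemma fpsX_comm f : fpsX * f = f * fpsX.
Proof.
apply: fpsP => k; rewrite fps_coefXM [RHS]fps_coefMr.
case: k => [|k]; rewrite big_ord_recl /= mulr0 add0r; first by rewrite big_ord0.
rewrite big_ord_recl /= mulr1 subSS subn0 big1 ?addr0 // => i _.
by rewrite mulr0.
Qed.

(* Inverses in the ring of power series; as usual in the library, a
   non-invertible element is its own inverse. *)
Definition fps_inv f : fps A := xget f [set g | g * f = 1 /\ f * g = 1]%classic.
Definition fps_unit : {pred fps A} :=
  [pred f | `[< exists g, g * f = 1 /\ f * g = 1 >]].

Fact fps_mulVf : {in fps_unit, left_inverse 1 fps_inv *%R}.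
Proof. by move=> f /asboolP/(xgetPex f) []. Qed.
Fact fps_mulfV : {in fps_unit, right_inverse 1 fps_inv *%R}.
Proof. by move=> f /asboolP/(xgetPex f) []. Qed.
Fact fps_unitP f g : g * f = 1 /\ f * g = 1 -> fps_unit f.
Proof. by move=> fg; apply/asboolP; exists g. Qed.
Fact fps_inv_out : {in [predC fps_unit], fps_inv =1 id}.
Proof.
move=> f /asboolP nf; rewrite /fps_inv; case: xgetP => // g _ fg.
by case: nf; exists g.
Qed.

HB.instance Definition _ := GRing.NzRing_hasMulInverse.Build (fps A)
  fps_mulVf fps_mulfV fps_unitP fps_inv_out.

Lemma fps_coefX_eq0 f k i : f.@0 = 0 -> (i < k)%N -> (f ^+ k).@i = 0.
Proof.
move=> f0; elim: k i => // k IHk i ik; rewrite exprS fps_coefM big1 // => j _.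
have [j0|j0] := posnP j; first by rewrite j0 f0 mul0r.
rewrite IHk ?mulr0 // ltn_subLR; last by rewrite -ltnS.
by rewrite (leq_trans ik) // -add1n leq_add2r.
Qed.

Lemma fps_unit1 f : f.@0 = 1 -> f \is a GRing.unit.
Proof.
move=> f0; pose u := 1 - f; have u0 : u.@0 = 0.
  by rewrite fps_coefD fps_coefN f0 fps_coef1 subrr.
have fE : f = 1 - u by rewrite opprB addrC subrK.
pose s k := \sum_(i < k) u ^+ i.
have sE k : f * s k = 1 - u ^+ k.
  by rewrite fE -opprB mulNr -subrX1 opprB.
have sC k : s k * f = f * s k.
  apply: commr_sym; apply: commr_sum => i _; apply: commrX.
  by rewrite /u; apply: commrB => //; apply: commr1.
pose g := FPS (fun k => (s k.+1).@k).
have gE k i : (i <= k)%N -> (s k.+1).@i = g.@i.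
  move=> ik; rewrite /= /s !fps_coef_sum.
  rewrite [RHS](big_ord_widen k.+1 (fun j => (u ^+ j).@i)) // [RHS]big_mkcond.
  by apply: eq_bigr => j _; case: ltnP => // ij; apply: fps_coefX_eq0.
apply/unitrP; exists g; split; apply: fpsP => k.
  transitivity ((s k.+1 * f).@k).
    by rewrite !fps_coefM; apply: eq_bigr => i _; rewrite gE // -ltnS.
  by rewrite sC sE fps_coefD fps_coefN fps_coefX_eq0 // subr0.
transitivity ((f * s k.+1).@k).
  by rewrite !fps_coefM; apply: eq_bigr => i _; rewrite gE // leq_subr.
by rewrite sE fps_coefD fps_coefN fps_coefX_eq0 // subr0.
Qed.

End FormalPowerSeries.

(* Matrices over a noncommutative ring; the library's [invmx] needs a
   commutative one. *)

Definition mx_inverse (A : nzRingType) k (X Y : 'M[A]_k) : Prop :=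
  Y *m X = 1%:M /\ X *m Y = 1%:M.

Definition mx_inv (A : nzRingType) k (X : 'M[A]_k) : 'M[A]_k :=
  xget X [set Y | mx_inverse X Y]%classic.

Lemma mx_invE (A : nzRingType) k (X Y : 'M[A]_k) :
  mx_inverse X Y -> mx_inv X = Y.
Proof.
move=> XY; have [VX _] := @xgetPex _ X [set Y | mx_inverse X Y]%classic (ex_intro _ Y XY).
case: XY => _ XY; by rewrite -[Y]mul1mx -VX -mulmxA XY mulmx1.
Qed.

Definition quasidet (A : unitRingType) k (X : 'M[A]_k) (i j : 'I_k) : A :=
  (mx_inv X j i)^-1.

Definition quasidet_defined (A : unitRingType) k (X : 'M[A]_k) (i j : 'I_k) :=
  (exists Y, mx_inverse X Y) /\ mx_inv X j i \is a GRing.unit.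

Definition one_plus_t (A : nzRingType) k (X : 'M[A]_k) : 'M[fps A]_k :=
  1%:M + fpsX A *: map_mx (@fpsC A) X.

Lemma one_plus_t_inverse (A : nzRingType) k (X : 'M[A]_k) :
  mx_inverse (one_plus_t X) (\matrix_(i, j) FPS (fun d => ((- X) ^+ d) i j)).
Proof.
have powS d : (- X) ^+ d.+1 + X *m (- X) ^+ d = 0.
  by rewrite exprS -mulmxE mulNmx addNr.
have powSr d : (- X) ^+ d.+1 + (- X) ^+ d *m X = 0.
  by rewrite exprSr -mulmxE mulmxN addNr.
set Y := \matrix_(i, j) _.
have coef1 i j d : fps_coef ((1%:M : 'M[fps A]_k) i j) d =
                   (if d is 0 then 1%:M : 'M[A]_k else 0) i j.
  by rewrite mxE; case: (i == j) / eqP => [->|/eqP/negPf ij];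
    rewrite ?fps_coef1; case: d => [|d]; rewrite !mxE ?eqxx ?ij.
split; apply/matrixP => i j; apply: fpsP => d; rewrite coef1.
- rewrite /one_plus_t mulmxDr mulmx1 mxE fps_coefD [Y i j]mxE.
  transitivity (((- X) ^+ d) i j +
                if d is d'.+1 then ((- X) ^+ d' *m X) i j else 0).
    congr (_ + _); transitivity (fps_coef
        (fpsX A * \sum_l (Y i l * fpsC (X l j))) d).
      rewrite mulr_sumr mxE; congr (fps_coef _ d); apply: eq_bigr => l _.
      by rewrite !mxE mulrA [in RHS]fpsX_comm mulrA.
    rewrite fps_coefXM; case: d => // d; rewrite fps_coef_sum mxE.
    by apply: eq_bigr => l _; rewrite fps_coefMC mxE.
  case: d => [|d]; rewrite ?expr0 ?addr0 //.
  by have /matrixP/(_ i j) := powSr d; rewrite mxE.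
- rewrite /one_plus_t mulmxDl mul1mx mxE fps_coefD [Y i j]mxE.
  transitivity (((- X) ^+ d) i j +
                if d is d'.+1 then (X *m (- X) ^+ d') i j else 0).
    congr (_ + _); rewrite -scalemxAl mxE fps_coefXM.
    case: d => // d; rewrite !mxE fps_coef_sum.
    by apply: eq_bigr => l _; rewrite !mxE fps_coefCM.
  case: d => [|d]; rewrite ?expr0 ?addr0 //.
  by have /matrixP/(_ i j) := powS d; rewrite mxE.
Qed.

Lemma quasidet_one_plus_t (A : nzRingType) k (X : 'M[A]_k) i :
  quasidet_defined (one_plus_t X) i i.
Proof.
split; first by eexists; apply: one_plus_t_inverse.
rewrite (mx_invE (one_plus_t_inverse X)) mxE; apply: fps_unit1.
by rewrite /= expr0 mxE eqxx.
Qed.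

Definition leading_mx (A : Type) k (X : 'M[A]_k) (i : 'I_k) : 'M[A]_i.+1 :=
  mxsub (widen_ord (ltn_ord i)) (widen_ord (ltn_ord i)) X.

Section Berezinian.
Variables (K : fieldType) (m n : nat).
Local Notation Ugl := (uea (gl K m n)).

Definition glE (i j : 'I_(m + n)) : Ugl := uea_gen (delta_mx i j : gl K m n).

Lemma glE_bracket i j k l :
  glE i j * glE k l
  - (-1) ^+ ((gl_parity i (+) gl_parity j) && (gl_parity k (+) gl_parity l))
      *: (glE k l * glE i j)
  = (k == j)%:R *: glE i l
    - ((i == l)%:R * (-1) ^+ ((gl_parity i (+) gl_parity j) &&
                              (gl_parity k (+) gl_parity l))) *: glE k j.
Proof.
rewrite (@uea_genM _ (gl K m n) _ _ _ _ (@gl_homog_delta K m n i j)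
  (@gl_homog_delta K m n k l)) [lsa_bracket _ _]gl_bracket_delta.
by rewrite /gl_bracket_unit raddfB /= !linearZ.
Qed.

Definition Ehat : 'M[Ugl]_(m + n) :=
  \matrix_(i, j) ((-1) ^+ gl_parity j *: glE i j).

(* An index a of type 'I_k stands for the number a + 1. *)

Definition berezinian : fps Ugl :=
  (\sum_(s : 'S_m) (-1) ^+ s *
     \prod_(a < m)
       one_plus_t (Ehat - a.+1%:R%:M + 1%:M) (lshift n (s a)) (lshift n a)) *
  (\sum_(s : 'S_n) (-1) ^+ s *
     \prod_(b < n)
       mx_inv (one_plus_t (Ehat - m%:R%:M + b.+1%:R%:M))
         (rshift m b) (rshift m (s b))).

Definition even_factor (a : 'I_m) : fps Ugl :=
  let i := lshift n a in
  quasidet (one_plus_t (leading_mx Ehat i - a.+1%:R%:M + 1%:M)) ord_max ord_max.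

Definition odd_factor (b : 'I_n) : fps Ugl :=
  let i := rshift m b in
  (quasidet (one_plus_t (leading_mx Ehat i - m%:R%:M + b.+1%:R%:M))
    ord_max ord_max)^-1.

Definition gauss_factor (i : 'I_(m + n)) : fps Ugl :=
  match split i with
  | inl a => even_factor a
  | inr b => odd_factor b
  end.

End Berezinian.

(* Main.v *)
(* A matrix F is "covariant" when E acts on its entries by the superbracket as
   on those of E itself.  Covariant matrices are closed under products, so all
   powers of E and hence the inverse of 1 + t(E + c) are covariant.  Therefore
   the corner entry of the inverse of the leading block of size i commutes with
   the entries of all smaller leading blocks, and the Gauss factors commute.

   For the factorization, X_r = 1 + t(E - r) restricted to the even indices, and
   the transpose of the odd block of the inverses of 1 + t(E - m + r + 1), both
   satisfy the RTT relation
     X_r(a,c) X_{r+1}(b,d) - X_r(b,c) X_{r+1}(a,d)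
       = X_{r+1}(b,d) X_r(a,c) - X_{r+1}(b,c) X_r(a,d),
   which makes the column determinant alternating in its columns.  Laplace
   expansion along the last (even case) or first (odd case) column followed by
   Cramer's rule then splits off one quasideterminant at a time. *)

Require Import Defs.
From mathcomp Require Import all_boot all_order all_fingroup all_algebra.
From mathcomp Require Import reals complex.

Set Implicit Arguments.
Unset Strict Implicit.
Unset Printing Implicit Defensive.

Import GRing.Theory.
Local Open Scope ring_scope.

(** * Covariant matrices and their closure properties *)

Lemma sumr_mulrb_eq (V : nmodType) (I : finType) (i : I) (F : I -> V) :
  \sum_r F r *+ (i == r) = F i.
Proof.
rewrite (bigD1 i) //= eqxx big1 ?addr0 // => r /negPf.
by rewrite eq_sym => ->.
Qed.

Section Covariance.
Variables (A : nzRingType) (k : nat) (p : 'I_k -> bool) (E : 'M[A]_k).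
Implicit Types F G : 'M[A]_k.

(** The supercommutator of [Ehat a b] and [Ehat i j] has this form. The column signs of [Ehat] leave
    (-1)^(p b) and (-1)^(p j); [p j] is written [p a] because a = j in the last term. *)
Definition covariant F := forall a b i j,
  E a b * F i j = (-1) ^+ ((p a (+) p b) && (p i (+) p j)) * (F i j * E a b)
    + ((-1) ^+ p b * F a j *+ (b == i)
    - (-1) ^+ (p a (+) ((p a (+) p b) && (p i (+) p a))) * F i b *+ (a == j)).

Lemma covariant0 : covariant 0.
Proof. by move=> a b i j; rewrite !mxE !mulr0 mul0r !mul0rn mulr0 subrr addr0. Qed.

Lemma covariantD F G : covariant F -> covariant G -> covariant (F + G).
Proof.
move=> cF cG a b i j; rewrite !mxE mulrDr cF cG mulrDl !mulrDr !mulrnDl opprD.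
by rewrite addrACA [X in _ + X = _]addrACA.
Qed.

Lemma covariantN F : covariant F -> covariant (- F).
Proof.
move=> cF a b i j; rewrite !mxE mulrN cF mulNr !mulrN !mulNrn !opprD.
by rewrite !opprK.
Qed.

Lemma covariantMn F d : covariant F -> covariant (F *+ d).
Proof.
move=> cF; elim: d => [|d IHd]; first exact: covariant0.
by rewrite mulrS; apply: covariantD.
Qed.

Lemma covariant1 : covariant 1%:M.
Proof.
move=> a b i j; rewrite !mxE.
have -> : (-1) ^+ ((p a (+) p b) && (p i (+) p j)) * ((i == j)%:R * E a b)
          = E a b * (i == j)%:R.
  have [->|_] := eqVneq i j; last by rewrite mul0r !mulr0.
  by rewrite addbb andbF !mul1r mulr1.
(* A contraction is nonzero only when both b = i and a = j, and then the two cancel. *)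
have [->|_] := eqVneq b i; have [->|_] := eqVneq a j.
- rewrite ?eqxx !mulr1n !mulr1.
  by case: (p j) (p i) => [] []; rewrite ?subrr ?addr0.
- by rewrite !mulr0 mul0rn subrr addr0.
- by rewrite !mulr0 mul0rn subrr addr0.
- by rewrite !mulr0n subrr addr0.
Qed.

(** A Leibniz rule. At the inner summation index r, the contraction of G at r = b and that of F at r
    = a both give [t * (F i b * G a j)], with opposite signs, so they cancel in the sum over r. *)
Lemma covariantM F G : covariant F -> covariant G -> covariant (F *m G).
Proof.
move=> cF cG a b i j; rewrite !mxE mulr_sumr.
have signCA (c : bool) (x y : A) : x * ((-1) ^+ c * y) = (-1) ^+ c * (x * y).
  by case: c; rewrite ?(mulN1r, mul1r) ?mulrN.
have signA (c c' : bool) (x : A) :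
    (-1) ^+ c * ((-1) ^+ c' * x) = (-1) ^+ (c (+) c') * x.
  by rewrite mulrA signr_addb.
pose t := (-1) ^+ (p b (+) ((p a (+) p b) && (p i (+) p b))) : A.
have step r : E a b * (F i r * G r j) =
   (-1) ^+ ((p a (+) p b) && (p i (+) p j)) * (F i r * G r j * E a b)
   + ((-1) ^+ p b * (F a r * G r j) *+ (b == i)
     - (-1) ^+ (p a (+) ((p a (+) p b) && (p i (+) p a))) * (F i r * G r b) *+ (a == j))
   + (t * (F i b * G a j) *+ (b == r) - t * (F i b * G a j) *+ (a == r)).
  rewrite mulrA cF mulrDl -!mulrA cG mulrBl.
  rewrite !(mulrDr, mulrN) !(mulrnAr, mulrnAl) -!mulrA !(signCA _ (F i r)) !signA.
  rewrite -!addrA; congr (_ + _).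
    by congr (_ ^+ _ * _); case: (p a) (p b) (p i) (p r) (p j) => [] [] [] [] [].
  set x := _ *+ (b == r); set y := _ *+ (a == j); set z := _ *+ (b == i).
  rewrite [x + _]addrC -!addrA [- y + _]addrCA; congr (_ + _).
  have -> : x = t * (F i b * G a j) *+ (b == r).
    rewrite /x; have [<-|//] := eqVneq b r; congr (_ ^+ _ * _ *+ _).
    by case: (p a) (p b) (p i) => [] [] [].
  have -> : y = (-1) ^+ (p a (+) ((p a (+) p b) && (p i (+) p a)))
                * (F i r * G r b) *+ (a == j).
    rewrite /y; congr (_ ^+ _ * _ *+ _).
    by case: (p a) (p b) (p i) (p r) => [] [] [] [].
  congr (_ + _); rewrite addrC; congr (_ - _).
  have [<-|//] := eqVneq a r; congr (_ ^+ _ * _ *+ _).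
  by case: (p a) (p b) (p i) => [] [] [].
rewrite (eq_bigr _ (fun r _ => step r)) !big_split /= !sumrN !sumr_mulrb_eq.
rewrite subrr addr0 !sumrMnl -!mulr_sumr -mulr_suml.
by [].
Qed.

Lemma covariantX F d : covariant F -> covariant (F ^+ d).
Proof.
move=> cF; elim: d => [|d IHd]; first exact: covariant1.
by rewrite exprS -mulmxE; apply: covariantM.
Qed.
End Covariance.

Section CovarianceOperations.
Variables (A : nzRingType) (k : nat) (p : 'I_k -> bool).
Implicit Types E X : 'M[A]_k.

Lemma covariant_shift E X c d :
  covariant p E X -> covariant p E (X - c%:R%:M + d%:R%:M).
Proof.
move=> cX; rewrite !(raddfMn (@scalar_mx A k)) /=.
have c1 := covariantMn _ (covariant1 p E).
by apply: covariantD; [apply: covariantD => //; apply: covariantN|].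
Qed.

Lemma covariant_leading E i : covariant p E E ->
  covariant (p \o widen_ord (ltn_ord i)) (leading_mx E i) (leading_mx E i).
Proof. by move=> cE a b i' j'; rewrite !mxE cE. Qed.

End CovarianceOperations.

(** * Commutation with inverses of 1 + tX *)

Lemma covariant_fps (A : nzRingType) k (p : 'I_k -> bool) (E : 'M[A]_k)
    (F : nat -> 'M[A]_k) : (forall l, covariant p E (F l)) ->
  covariant p (map_mx (@fpsC A) E) (\matrix_(i, j) FPS (fun l => F l i j)).
Proof.
move=> cF a b i j; rewrite !mxE.
have coef_sign (c : bool) (f : fps A) l :
    fps_coef ((-1) ^+ c * f) l = (-1) ^+ c * fps_coef f l.
  by case: c; rewrite ?(mulN1r, mul1r).
have coefMb (c : bool) (f : fps A) l : fps_coef (f *+ c) l = fps_coef f l *+ c.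
  by case: c.
apply: fpsP => l; rewrite fps_coefCM !(fps_coefD, fps_coefN, coefMb, coef_sign).
by rewrite fps_coefMC /= cF.
Qed.

(** The coefficients of the inverse are the powers of -X, each of them covariant. *)
Lemma covariant_inv (A : nzRingType) k (p : 'I_k -> bool) (E X : 'M[A]_k) :
  covariant p E X -> covariant p (map_mx (@fpsC A) E) (mx_inv (one_plus_t X)).
Proof.
move=> cX; rewrite (mx_invE (one_plus_t_inverse X)).
by apply: covariant_fps => l; apply/covariantX/covariantN.
Qed.

Lemma comm_fpsC (A : nzRingType) (x : A) (f : fps A) :
  GRing.comm (fpsC x) f <-> forall l, GRing.comm x (fps_coef f l).
Proof.
split=> [xf l|xf]; last by apply: fpsP => l; rewrite fps_coefCM fps_coefMC xf.
by rewrite /GRing.comm -fps_coefCM xf fps_coefMC.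
Qed.

(** The corner entry is even, so no sign appears, and both contractions vanish because neither [a]
    nor [b] is the last index. *)
Lemma comm_inv_last (A : nzRingType) k (p : 'I_k.+1 -> bool) (E X : 'M[A]_k.+1) a b :
  covariant p E X -> a != ord_max -> b != ord_max ->
  GRing.comm (fpsC (E a b)) (mx_inv (one_plus_t X) ord_max ord_max).
Proof.
move=> cX /negPf aM /negPf bM.
have := covariant_inv cX a b ord_max ord_max; rewrite /GRing.comm mxE => ->.
by rewrite aM bM addbb andbF !mulr0n subrr addr0 mul1r.
Qed.

Lemma comm_mx_inverse (B : nzRingType) k (X Y : 'M[B]_k) z :
  mx_inverse X Y -> (forall i j, GRing.comm z (X i j)) ->
  forall i j, GRing.comm z (Y i j).
Proof.
move=> [YX XY] zX i j.
have mulMz (M : 'M[B]_k) a b : (M *m z%:M) a b = M a b * z.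
  rewrite mxE (bigD1 b) //= mxE eqxx big1 ?addr0 // => l /negPf lb.
  by rewrite mxE lb mulr0.
have zXM : z%:M *m X = X *m z%:M.
  by apply/matrixP => a b; rewrite mul_scalar_mx mulMz mxE zX.
have /matrixP/(_ i j) : z%:M *m Y = Y *m z%:M.
  by rewrite -[LHS]mul1mx -YX -mulmxA [X *m _]mulmxA -zXM -!mulmxA XY mulmx1.
by rewrite mul_scalar_mx mulMz mxE.
Qed.

Lemma mx_inv_one_plus_t (A : nzRingType) k (X : 'M[A]_k) :
  mx_inverse (one_plus_t X) (mx_inv (one_plus_t X)).
Proof. by rewrite (mx_invE (one_plus_t_inverse X)); apply: one_plus_t_inverse. Qed.

Lemma one_plus_tE (A : nzRingType) k (X : 'M[A]_k) i j :
  one_plus_t X i j = (i == j)%:R + fpsX A * fpsC (X i j).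
Proof. by rewrite !mxE. Qed.

(** * Pairwise commutation of the Gauss factors *)

Section GaussFactors.
Variables (K : fieldType) (m n : nat).
Local Notation Ehat := (Ehat K m n).

Lemma Ehat_covariant : covariant (@gl_parity m n) Ehat Ehat.
Proof.
move=> a b i j; rewrite !mxE.
have /eqP := glE_bracket K a b i j; rewrite subr_eq => /eqP.
rewrite [X in _ = X]addrC -!(scalerAl, scalerAr) => ->.
rewrite [i == b]eq_sym !mulr_sign.
set P := glE K i j * _.
have [bi|_] := eqVneq b i; have [aj|_] := eqVneq a j;
  rewrite -?bi -?aj ?mul0r ?mul1r ?scale0r ?scale1r !scaler_sign;
  case: (gl_parity a) (gl_parity b) (gl_parity i) (gl_parity j) => [] [] [] [] /=;
  by rewrite ?mulr1n ?mulr0n ?(opprD, opprK, subr0, add0r, addr0, oppr0).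
Qed.

(** This is an odd Gauss factor or the inverse of an even one. The shifts are left free so that one
    commutation lemma serves all factors. *)
Definition inv_corner (i : 'I_(m + n)) (c d : nat) : fps (uea (gl K m n)) :=
  mx_inv (one_plus_t (leading_mx Ehat i - c%:R%:M + d%:R%:M)) ord_max ord_max.

Lemma comm_Ehat_inv_corner (j a b : 'I_(m + n)) c d :
  (a < j)%N -> (b < j)%N -> GRing.comm (fpsC (Ehat a b)) (inv_corner j c d).
Proof.
(* [w] moves an index into the leading block; below [j] it is faithful and avoids the last index, as
   [comm_inv_last] requires. *)
move=> aj bj; pose w (l : 'I_(m + n)) : 'I_j.+1 := inord l.
have wE (l : 'I_(m + n)) : (l < j)%N -> widen_ord (ltn_ord j) (w l) = l.
  by move=> lj; apply: val_inj; rewrite /= inordK // ltnW.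
have wM (l : 'I_(m + n)) : (l < j)%N -> w l != ord_max.
  move=> lj; apply/eqP => /(congr1 val); rewrite /= inordK ?ltnS ?(ltnW lj) // => lE.
  by rewrite lE ltnn in lj.
have -> : Ehat a b = leading_mx Ehat j (w a) (w b) by rewrite [RHS]mxE !wE.
apply: comm_inv_last (wM _ aj) (wM _ bj).
apply: covariant_shift; exact: covariant_leading Ehat_covariant.
Qed.

(** The block ending at [i] is built from t, integers and [Ehat a b] with a, b <= i < j, all
    commuting with the corner at [j]; commutation then passes to the inverse of the block. *)
Lemma comm_inv_corner (i j : 'I_(m + n)) c d c' d' : (i < j)%N ->
  GRing.comm (inv_corner i c d) (inv_corner j c' d').
Proof.
move=> ij; apply: commr_sym.
apply: comm_mx_inverse (mx_inv_one_plus_t _) _ _ _ => a b.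
have lt_j (l : 'I_i.+1) : (widen_ord (ltn_ord i) l < j)%N.
  by rewrite /= (leq_ltn_trans _ ij) // -ltnS ltn_ord.
rewrite one_plus_tE; apply: commrD; first exact: commr_nat.
apply: commrM; first exact/commr_sym/fpsX_comm.
apply/commr_sym/comm_fpsC => l; apply: commr_sym; rewrite mxE.
apply: commrD; last by rewrite mxE; apply/commrMn/commr_nat.
rewrite mxE; apply: commrD; last by rewrite !mxE; apply/commrN/commrMn/commr_nat.
by rewrite mxE; apply: commr_sym; move: l; apply/comm_fpsC/comm_Ehat_inv_corner.
Qed.

Lemma gauss_factor_inv_corner i : exists c d,
  @gauss_factor K m n i = inv_corner i c d \/ gauss_factor K i = (inv_corner i c d)^-1.
Proof.
rewrite /gauss_factor; case: split_ordP => a ->.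
- by exists a.+1, 1; right.
- by exists m, a.+1; left; rewrite /odd_factor /quasidet invrK.
Qed.

Lemma gauss_factor_comm (i j : 'I_(m + n)) :
  GRing.comm (gauss_factor K i) (gauss_factor K j).
Proof.
wlog ij : i j / (i < j)%N.
  move=> H; case: (ltngtP i j) => [|ji|/ord_inj->]; first exact: H.
    exact/commr_sym/H.
  exact: commr_refl.
have [c [d Ei]] := gauss_factor_inv_corner i.
have [c' [d' Ej]] := gauss_factor_inv_corner j.
have C := comm_inv_corner c d c' d' ij.
case: Ei Ej => -> [] ->; [|exact: commrV|exact/commr_sym/commrV/commr_sym|].
  exact: C.
exact/commrV/commr_sym/commrV/commr_sym.
Qed.

End GaussFactors.

(** * Column determinants over a noncommutative ring *)

Lemma big_perm_fix (V : nmodType) n (i : 'I_n.+1) (F : 'S_n.+1 -> V) :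
  \sum_(s : 'S_n.+1 | s i == i) F s = \sum_(s : 'S_n) F (lift_perm i i s).
Proof.
have lift_inj' : injective (fun s : 'S_n => lift_perm i i s).
  move=> s s' /permP ss'; apply/permP => l.
  by apply: (@lift_inj _ i); rewrite -!(lift_perm_lift i).
pose D := [set s : 'S_n.+1 | s i == i].
have DE : [set lift_perm i i s | s : 'S_n] = D.
  apply/eqP; rewrite eqEcard; apply/andP; split.
    by apply/subsetP => _ /imsetP[s _ ->]; rewrite inE lift_perm_id.
  (* The inclusion is an equality since both sets have n! elements; permutations fixing [i] are
     counted as those supported off [i]. *)
  have -> : D = [set s | perm_on [set~ i] s].
    apply/setP => s; rewrite !inE; apply/eqP/subsetP => [si l | sP].
      by rewrite !inE; apply: contraNneq => ->; rewrite si.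
    by apply/eqP; apply: contraTT isT => si; have := sP i si; rewrite !inE eqxx.
  by rewrite cardsE card_perm cardsC1 card_ord /= card_imset // card_Sn.
rewrite -[RHS](big_imset F) /=; last by move=> s s' _ _; apply: lift_inj'.
by rewrite DE; apply: eq_bigl => s; rewrite inE.
Qed.

(** The default [i] of [insubd] is never reached, as [l] stays below [n]. *)
Lemma prod_ord_split_pair (B : nzRingType) n (i j : 'I_n) (F : 'I_n -> B) :
  j = i.+1 :> nat ->
  \prod_a F a = \prod_(0 <= l < i) F (insubd i l) * (F i * F j)
                * \prod_(j.+1 <= l < n) F (insubd i l).
Proof.
move=> ji; pose G l := F (insubd i l).
have -> : \prod_a F a = \prod_(0 <= l < n) G l.
  by rewrite big_mkord; apply: eq_bigr => a _; rewrite /G valKd.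
rewrite (big_cat_nat (n := i)) //=; last exact/ltnW.
rewrite (big_ltn (ltn_ord i)) -ji (big_ltn (ltn_ord j)) /G !valKd.
by rewrite !mulrA.
Qed.

Section ColumnDeterminant.
Variable B : nzRingType.

(** The left side is antisymmetric in the rows a, b and the right side in the columns c, d: the
    relation trades one antisymmetry for the other. *)
Definition rtt n (X : nat -> 'M[B]_n) := forall r a b c d,
  X r a c * X r.+1 b d - X r b c * X r.+1 a d =
  X r.+1 b d * X r a c - X r.+1 b c * X r a d.

(** The column map [c] is kept general so that columns can be permuted or repeated. *)
Definition cdet n (X : nat -> 'M[B]_n) (c : 'I_n -> 'I_n) : B :=
  \sum_(s : 'S_n) (-1) ^+ s * \prod_(a < n) X a (s a) (c a).

Section Alternation.
Variables (n : nat) (X : nat -> 'M[B]_n).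
Hypothesis rttX : rtt X.

(* Pairs s with tperm i j * s and rewrites the two middle factors by the RTT
   relation; the result is visibly alternating in (c i, c j). *)
Lemma cdet_pair (i j : 'I_n) c : j = i.+1 :> nat ->
  cdet X c = \sum_(s : 'S_n | ~~ s)
    \prod_(0 <= l < i) X (insubd i l) (s (insubd i l)) (c (insubd i l))
    * (X j (s j) (c j) * X i (s i) (c i) - X j (s j) (c i) * X i (s i) (c j))
    * \prod_(j.+1 <= l < n) X (insubd i l) (s (insubd i l)) (c (insubd i l)).
Proof.
move=> ji; have ij : i != j by rewrite -val_eqE /= ji neq_ltn ltnSn.
rewrite /cdet (bigID (fun s : 'S_n => s)) /= addrC.
rewrite [X in _ + X](reindex_inj (mulgI (tperm i j))) /=.
under [X in _ + X]eq_bigl do rewrite odd_mul_tperm ij.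
rewrite -big_split; apply: eq_bigr => s s0.
rewrite odd_mul_tperm ij (negPf s0) expr0 expr1 mul1r mulN1r.
rewrite !(prod_ord_split_pair _ ji) !permM tpermL tpermR.
have off (l : nat) : (l < n)%N -> (l != i)%N -> (l != j)%N ->
    (tperm i j * s)%g (insubd i l) = s (insubd i l).
  move=> ln li lj; rewrite permM tpermD // -val_eqE /= val_insubd ln eq_sym //.
have -> : \prod_(0 <= l < i)
      X (insubd i l) ((tperm i j * s)%g (insubd i l)) (c (insubd i l))
    = \prod_(0 <= l < i) X (insubd i l) (s (insubd i l)) (c (insubd i l)).
  apply: eq_big_nat => l /andP[_ li].
  by rewrite off ?(ltn_trans li) ?ji ?ltn_eqF // ltnW.
have -> : \prod_(j.+1 <= l < n)
      X (insubd i l) ((tperm i j * s)%g (insubd i l)) (c (insubd i l))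
    = \prod_(j.+1 <= l < n) X (insubd i l) (s (insubd i l)) (c (insubd i l)).
  apply: eq_big_nat => l /andP[jl ln].
  by rewrite off // gtn_eqF // (leq_trans _ jl) // ji ltnS leqnSn.
rewrite /= -mulrBl -mulrBr; congr (_ * _ * _).
by have := rttX i (s i) (s j) (c i) (c j); rewrite -ji => ->.
Qed.

(** In [cdet_pair] only the middle factor involves [c i] and [c j], and it changes sign when they
    are swapped. *)
Lemma cdet_tperm (i j : 'I_n) c : j = i.+1 :> nat ->
  cdet X (c \o tperm i j) = - cdet X c.
Proof.
move=> ji; rewrite !(cdet_pair _ ji) -sumrN; apply: eq_bigr => s _ /=.
have off (l : nat) : (l < n)%N -> (l != i)%N -> (l != j)%N ->
    tperm i j (insubd i l) = insubd i l.
  move=> ln li lj; rewrite tpermD // -val_eqE /= val_insubd ln eq_sym //.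
rewrite tpermL tpermR -[RHS]mulNr -[X in _ = X * _]mulrN opprB; congr (_ * _ * _).
  apply: eq_big_nat => l /andP[_ li].
  by rewrite off ?(ltn_trans li) ?ji ?ltn_eqF // ltnW.
apply: eq_big_nat => l /andP[jl ln].
by rewrite off // gtn_eqF // (leq_trans _ jl) // ji ltnS leqnSn.
Qed.

(** Induction on j - i: adjacent equal columns cancel in [cdet_pair]; otherwise transposing columns
    j - 1 and j brings the equal ones closer. *)
Lemma cdet_alternate (i j : 'I_n) c : (i < j)%N -> c i = c j -> cdet X c = 0.
Proof.
have [d] := ubnP (j - i); elim: d j c => // d IHd j c jd ij cij.
have [ji|ji] := eqVneq (j : nat) i.+1.
  rewrite (cdet_pair _ ji) big1 // => s _.
  by rewrite cij subrr mulr0 mul0r.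
have j_gt0 : (0 < j)%N by apply: leq_ltn_trans ij.
have ij' : (i < j.-1)%N by rewrite -ltnS prednK // ltn_neqAle eq_sym ji.
have lt_n : (j.-1 < n)%N by rewrite (leq_ltn_trans (leq_pred _)).
pose j' := Ordinal lt_n.
have jj' : j = j'.+1 :> nat by rewrite /= prednK.
apply/eqP; rewrite -oppr_eq0 -(cdet_tperm _ jj'); apply/eqP/(IHd j') => //=.
  by rewrite -ltnS (leq_trans _ jd) // ltnS jj' subSn ?ltnSn // ltnW.
rewrite tpermL tpermD // -val_eqE /= eq_sym ?ltn_eqF //.
Qed.
End Alternation.

Definition lift_block n (i : 'I_n.+1) (X : nat -> 'M[B]_n.+1) a : 'M[B]_n :=
  mxsub (lift i) (lift i) (X a).

Lemma widen_lift_max n (a : 'I_n) : widen_ord (leqnSn n) a = lift ord_max a.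
Proof. by apply: ord_inj; rewrite lift_max. Qed.

(** Cramer's rule from the right: [u] solves X_a u = g_a e_a on the leading block ending at [a].
    Pairing the cofactors of the last column with this solution leaves the last minor times the last
    [g], and induction applies to that minor. *)
Lemma cdet_factor_last n (X : nat -> 'M[B]_n) (g : 'I_n -> B) : rtt X ->
  (forall a : 'I_n, exists u : 'I_n -> B, u a = 1 /\ forall k : 'I_n,
     (k <= a)%N -> \sum_(j < n | (j <= a)%N) X a k j * u j = g a *+ (k == a)) ->
  cdet X id = \prod_a g a.
Proof.
elim: n X g => [|n IHn] X g rttX gP.
  rewrite /cdet big_ord0 (eq_bigr (fun=> 1)) => [|s _].
    by rewrite sumr_const card_Sn.
  have -> : s = 1%g by apply/permP => -[].
  by rewrite odd_perm1 big_ord0 mulr1.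
(* Signs are included, so this is a cofactor; it stands to the left of the entry of the last column,
   which is the rightmost factor. *)
pose minor k := \sum_(s : 'S_n.+1 | s ord_max == k)
   (-1) ^+ s * \prod_(a < n) X a (s (lift ord_max a)) (lift ord_max a).
have laplace j : \sum_k minor k * X n k j = cdet X id *+ (j == ord_max).
  (* Column [j] replaces the last one; unless [j] is the last index, a column is repeated and the
     determinant vanishes. *)
  pose c (a : 'I_n.+1) := if a == ord_max then j else a.
  transitivity (cdet X c).
    rewrite /cdet (partition_big (fun s : 'S_n.+1 => s ord_max) predT) //=.
    apply: eq_bigr => k _; rewrite /minor mulr_suml; apply: eq_bigr => s /eqP <-.
    rewrite big_ord_recr /= mulrA /c eqxx; congr (_ * _ * _).
    apply: eq_bigr => a _; rewrite widen_lift_max.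
    by rewrite [_ == ord_max]eq_sym (negPf (neq_lift _ _)).
  have [jM|jn] := eqVneq j ord_max.
    by apply: eq_bigr => s _; congr (_ * _); apply: eq_bigr => a _;
       rewrite /c jM; case: eqP => // ->.
  apply: (cdet_alternate rttX (i := j) (j := ord_max)).
    by rewrite ltn_neqAle -ltnS ltn_ord andbT.
  by rewrite /c eqxx (negPf jn).
have [u [u1 uP]] := gP ord_max.
have cX : cdet X id = minor ord_max * g ord_max.
  transitivity (\sum_j (\sum_k minor k * X n k j) * u j).
    under eq_bigr do rewrite laplace mulrnAl.
    by under eq_bigr do rewrite eq_sym; rewrite sumr_mulrb_eq u1 mulr1.
  under eq_bigr do rewrite mulr_suml; rewrite exchange_big /=.
  under eq_bigr => k _.
    under eq_bigr do rewrite -mulrA.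
    rewrite -mulr_sumr.
    have -> : \sum_i X n k i * u i = g ord_max *+ (ord_max == k).
      rewrite [_ == k]eq_sym -(uP k (leq_ord k)).
      by apply: eq_bigl => i; rewrite leq_ord.
    rewrite mulrnAr; over.
  by rewrite sumr_mulrb_eq.
rewrite cX big_ord_recr; congr (_ * _).
rewrite -(IHn (lift_block ord_max X)).
- rewrite /minor big_perm_fix; apply: eq_bigr => s _.
  rewrite odd_lift_perm addbb; congr (_ * _); apply: eq_bigr => a _.
  by rewrite lift_perm_lift mxE.
- by move=> r a b c d; rewrite !mxE.
(* The system at [a] involves only indices up to [a], so deleting the last index leaves it
   intact. *)
move=> a; have [v [v1 vP]] := gP (widen_ord (leqnSn n) a).
exists (v \o lift ord_max); split; first by rewrite /= -widen_lift_max.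
move=> k ka; rewrite widen_lift_max in vP.
have := vP (lift ord_max k); rewrite !lift_max => /(_ ka).
rewrite (inj_eq lift_inj) widen_lift_max => <-.
rewrite big_mkcond [RHS]big_mkcond big_ord_recr /= leqNgt ltn_ord addr0.
by apply: eq_bigr => j _; rewrite widen_lift_max !mxE.
Qed.

(** Mirror image of [cdet_factor_last]: the first column gives the leftmost factor, so the vectors
    act from the left, on trailing blocks, and the remaining minor uses the family shifted by
    one. *)
Lemma cdet_factor_first n (X : nat -> 'M[B]_n) (f : 'I_n -> B) : rtt X ->
  (forall b : 'I_n, exists w : 'I_n -> B, w b = 1 /\ forall l : 'I_n,
     (b <= l)%N -> \sum_(k < n | (b <= k)%N) w k * X b l k = f b *+ (l == b)) ->
  cdet X id = \prod_b f b.
Proof.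
elim: n X f => [|n IHn] X f rttX fP.
  rewrite /cdet big_ord0 (eq_bigr (fun=> 1)) => [|s _].
    by rewrite sumr_const card_Sn.
  have -> : s = 1%g by apply/permP => -[].
  by rewrite odd_perm1 big_ord0 mulr1.
pose minor k := \sum_(s : 'S_n.+1 | s ord0 == k)
   (-1) ^+ s * \prod_(a < n) X a.+1 (s (lift ord0 a)) (lift ord0 a).
have laplace j : \sum_k X 0 k j * minor k = cdet X id *+ (j == ord0).
  pose c (a : 'I_n.+1) := if a == ord0 then j else a.
  transitivity (cdet X c).
    rewrite /cdet (partition_big (fun s : 'S_n.+1 => s ord0) predT) //=.
    apply: eq_bigr => k _; rewrite /minor mulr_sumr; apply: eq_bigr => s /eqP <-.
    rewrite big_ord_recl /= mulrA commr_sign -mulrA /c eqxx; congr (_ * (_ * _)).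
  have [j0|jn] := eqVneq j ord0.
    by apply: eq_bigr => s _; congr (_ * _); apply: eq_bigr => a _;
       rewrite /c j0; case: eqP => // ->.
  apply: (cdet_alternate rttX (i := ord0) (j := j)).
    by rewrite lt0n.
  by rewrite /c eqxx (negPf jn).
have [w [w1 wP]] := fP ord0.
have cX : cdet X id = f ord0 * minor ord0.
  transitivity (\sum_j w j * (\sum_k X 0 k j * minor k)).
    under eq_bigr do rewrite laplace mulrnAr.
    by under eq_bigr do rewrite eq_sym; rewrite sumr_mulrb_eq w1 mul1r.
  under eq_bigr do rewrite mulr_sumr; rewrite exchange_big /=.
  under eq_bigr => k _.
    under eq_bigr do rewrite mulrA.
    rewrite -mulr_suml.
    have -> : \sum_i w i * X 0 k i = f ord0 *+ (ord0 == k).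
      by rewrite [_ == k]eq_sym -(wP k (leq0n k)).
    rewrite mulrnAl; over.
  by rewrite sumr_mulrb_eq.
rewrite cX big_ord_recl; congr (_ * _).
rewrite -(IHn (fun a => lift_block ord0 X a.+1)).
- rewrite /minor big_perm_fix; apply: eq_bigr => s _.
  rewrite odd_lift_perm addbb; congr (_ * _); apply: eq_bigr => a _.
  by rewrite lift_perm_lift mxE.
- by move=> r a b c d; rewrite !mxE.
move=> a; have [v [v1 vP]] := fP (lift ord0 a).
exists (v \o lift ord0); split=> // k ka.
have := vP (lift ord0 k); rewrite !lift0 ltnS => /(_ ka).
rewrite (inj_eq lift_inj) => <-.
rewrite big_mkcond [RHS]big_mkcond big_ord_recl /= add0r.
by apply: eq_bigr => j _; rewrite mxE.
Qed.

End ColumnDeterminant.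

(** * Commutators with 1 + tX and relations between shifted inverses *)

Lemma covariant_one_plus_t (A : nzRingType) k (p : 'I_k -> bool) (E X : 'M[A]_k) :
  covariant p E X -> covariant p (map_mx (@fpsC A) E) (one_plus_t X).
Proof.
move=> cX; pose F l : 'M[A]_k := if l is l'.+1 then if l' is 0 then X else 0 else 1%:M.
have -> : one_plus_t X = \matrix_(i, j) FPS (fun l => F l i j).
  apply/matrixP => i j; rewrite one_plus_tE mxE; apply: fpsP => l.
  rewrite fps_coefD fps_coefXM.
  have -> : fps_coef ((i == j)%:R : fps A) l = ((i == j) && (l == 0))%:R.
    by case: (i == j) => //; rewrite fps_coef1.
  case: l => [|[|l]] /=; rewrite ?andbT ?andbF ?add0r ?addr0 ?mxE //.
apply: covariant_fps => -[|[|l]]; [exact: covariant1|done|exact: covariant0].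
Qed.

Lemma one_plus_t_leading (A : nzRingType) k (E : 'M[A]_k) i c d :
  one_plus_t (leading_mx E i - c%:R%:M + d%:R%:M) =
  leading_mx (one_plus_t (E - c%:R%:M + d%:R%:M)) i.
Proof.
have wI a b : (widen_ord (ltn_ord i) a == widen_ord (ltn_ord i) b) = (a == b) by [].
by apply/matrixP => a b; rewrite !mxE !wI.
Qed.

(** Since i and j have equal parity, [G i j] is even and the superbracket is an ordinary commutator.
    The scalar part of S is central, so only t times the action of E remains. *)
Lemma one_plus_t_commutator (A : nzRingType) k (p : 'I_k -> bool)
    (E : 'M[A]_k) c d G e i j a b :
  covariant p (map_mx (@fpsC A) E) G -> p i = e -> p j = e ->
  let S := one_plus_t (E - c%:R%:M + d%:R%:M) in
  S a b * G i j = G i j * S a b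
    + (-1) ^+ e * (fpsX A * (G a j *+ (b == i) - G i b *+ (a == j))).
Proof.
move=> cG pi pj /=.
pose s : A := 1 *- c + 1 *+ d.
have -> : one_plus_t (E - c%:R%:M + d%:R%:M) a b =
    (a == b)%:R + fpsX A * ((map_mx (@fpsC A) E) a b + fpsC s *+ (a == b)).
  rewrite one_plus_tE; congr (_ + _ * _); rewrite !mxE -addrA.
  apply: fpsP => l; rewrite fps_coefD /s; case: (a == b); case: l => [|l] //=;
    by rewrite ?(subr0, addr0, oppr0, mulr0n).
have sC (f : fps A) : fpsC s * f = f * fpsC s.
  apply/comm_fpsC => l; apply: commr_sym; rewrite /s.
  by apply: commrD; [apply: commrN|]; apply: commr_nat.
set h := map_mx _ _ _ _ + _.
have hG : h * G i j =
    G i j * h + (-1) ^+ e * (G a j *+ (b == i) - G i b *+ (a == j)).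
  rewrite /h mulrDl cG pi pj addbb andbF mul1r mulrDr.
  rewrite !(mulrnAl, mulrnAr) sC -!addrA; congr (_ + _); rewrite addrA addrC.
  congr (_ + _); rewrite mulrBr !mulrnAr.
  have [bi|_] := eqVneq b i; have [aj|_] := eqVneq a j;
    by rewrite ?bi ?aj ?pi ?pj ?addbb ?andbF ?addbF.
rewrite mulrDl -mulrA hG [X in _ = X + _]mulrDr [X in _ + X]mulrDr addrA.
congr (_ + _ + _).
- by case: (a == b); rewrite ?(mul1r, mulr1, mul0r, mulr0).
- by rewrite !mulrA fpsX_comm.
- by rewrite !mulrA commr_sign.
Qed.

Section InverseRelation.
Variables (B : nzRingType) (T : B).
Hypothesis T_central : forall x, T * x = x * T.

(** Inserting ZY = 1 makes W_ij Z_ab the sum of Z_ac Y_cd W_ij Z_db; Y is moved past W and absorbed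
    by YZ = 1. In the correction terms the hypotheses on TZW and TWZ eliminate T. *)
Lemma inverse_relation k (Y Z W : 'M[B]_k) i j a b :
  mx_inverse Y Z -> T *: (Z *m W) = Z - W -> T *: (W *m Z) = Z - W ->
  (forall c d, Y c d * W i j =
     W i j * Y c d - T * (W c j *+ (d == i) - W i d *+ (c == j))) ->
  W i j * Z a b = Z a b * W i j + (W a j * Z i b - Z a j * W i b).
Proof.
move=> [ZY YZ] TZW TWZ YW.
have sum1 (x : 'I_k -> B) (M : 'M[B]_k) c : M = 1%:M -> \sum_d M c d * x d = x c.
  move=> ->; rewrite -[RHS](sumr_mulrb_eq c).
  by apply: eq_bigr => d _; rewrite mxE mulr_natl.
have sum1r (x : 'I_k -> B) (M : 'M[B]_k) c : M = 1%:M -> \sum_d x d * M d c = x c.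
  move=> ->; rewrite -[RHS](sumr_mulrb_eq c).
  by apply: eq_bigr => d _; rewrite mxE mulr_natr eq_sym.
transitivity (\sum_d \sum_c Z a c * (Y c d * W i j) * Z d b).
  rewrite -(sum1 (fun d => W i j * Z d b) _ a ZY); apply: eq_bigr => d _.
  rewrite mxE mulr_suml; apply: eq_bigr => c _.
  by rewrite !mulrA.
have step c d : Z a c * (Y c d * W i j) * Z d b =
    Z a c * W i j * (Y c d * Z d b)
    - T * (Z a c * W c j * Z d b) *+ (i == d)
    + T * (Z a c * (W i d * Z d b)) *+ (j == c).
  have TC (x y : B) : x * (T * y) = T * (x * y) by rewrite mulrA -T_central mulrA.
  rewrite YW !mulrBr !mulrBl !TC opprB addrA addrAC [i == d]eq_sym [j == c]eq_sym.
  by rewrite !(mulrnAl, mulrnAr) !mulrA.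
under eq_bigr do (under eq_bigr do rewrite step; rewrite big_split sumrB /=).
rewrite big_split sumrB /= -addrA; congr (_ + _).
  rewrite exchange_big /= -[RHS](sum1r (fun c => Z a c * W i j) _ b YZ).
  by apply: eq_bigr => c _; rewrite mxE mulr_sumr.
have ZWE : T * (\sum_c Z a c * W c j) = Z a j - W a j.
  by have /matrixP/(_ a j) := TZW; rewrite !mxE.
have WZE : T * (\sum_d W i d * Z d b) = Z i b - W i b.
  by have /matrixP/(_ i b) := TWZ; rewrite !mxE.
transitivity (- ((Z a j - W a j) * Z i b) + Z a j * (Z i b - W i b)).
  congr (- _ + _).
    under eq_bigr do rewrite sumrMnl -mulr_sumr -mulr_suml mulrA ZWE.
    by rewrite sumr_mulrb_eq.
  under eq_bigr do rewrite sumr_mulrb_eq.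
  by rewrite -!mulr_sumr mulrA T_central -mulrA WZE.
by rewrite mulrBl mulrBr opprB addrA subrK.
Qed.

(** Resolvent identities: Z - W = Z(Y' - Y)W = W(Y' - Y)Z. *)
Lemma inverse_shift k (Y Y' Z W : 'M[B]_k) : mx_inverse Y Z -> mx_inverse Y' W ->
  Y' = Y + T%:M -> T *: (Z *m W) = Z - W /\ T *: (W *m Z) = Z - W.
Proof.
move=> [ZY YZ] [WY YW] YT.
have TM (M : 'M[B]_k) : M *m T%:M = T *: M.
  apply/matrixP => i j; rewrite !mxE (bigD1 j) //= mxE eqxx big1 ?addr0 ?T_central //.
  by move=> l /negPf lj; rewrite mxE lj mulr0.
split.
  rewrite scalemxAl -TM; have -> : T%:M = Y' - Y by rewrite YT addrC addKr.
  by rewrite mulmxBr ZY mulmxBl mul1mx -mulmxA YW mulmx1.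
rewrite scalemxAl -TM; have -> : T%:M = Y' - Y by rewrite YT addrC addKr.
by rewrite mulmxBr WY mulmxBl mul1mx -mulmxA YZ mulmx1.
Qed.

End InverseRelation.

(** * RTT relations for the even and odd blocks *)

Section Decomposition.
Variables (K : fieldType) (m n : nat).
Local Notation Ehat := (Ehat K m n).
Local Notation U := (uea (gl K m n)).

Definition even_mx r : 'M[fps U]_(m + n) :=
  one_plus_t (Ehat - r.+1%:R%:M + 1%:R%:M).
Definition odd_mx r : 'M[fps U]_(m + n) :=
  one_plus_t (Ehat - m%:R%:M + r.+1%:R%:M).

Definition odd_inv r := mx_inv (odd_mx r).

Definition even_block r : 'M[fps U]_m :=
  \matrix_(i, j) even_mx r (lshift n i) (lshift n j).
(** Transposed because the permutation acts on columns of the inverse in the Berezinian but on rows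
    in [cdet]. *)
Definition odd_block r : 'M[fps U]_n :=
  \matrix_(i, j) odd_inv r (rshift m j) (rshift m i).

Lemma even_blockE r i j :
  even_block r i j = even_mx r (lshift n i) (lshift n j).
Proof. exact: mxE. Qed.

Lemma odd_blockE r i j :
  odd_block r i j = odd_inv r (rshift m j) (rshift m i).
Proof. exact: mxE. Qed.

Lemma berezinianE : berezinian K m n = cdet even_block id * cdet odd_block id.
Proof.
rewrite /berezinian; congr (_ * _); apply: eq_bigr => s _; congr (_ * _).
  by apply: eq_bigr => a _; rewrite [RHS]mxE.
by apply: eq_bigr => a _; rewrite [RHS]mxE.
Qed.

Lemma one_plus_tD (X : 'M[U]_(m + n)) :
  one_plus_t (X + 1%:M) = one_plus_t X + (fpsX U)%:M.
Proof.
apply/matrixP => i j; rewrite one_plus_tE ![in RHS]mxE ![in LHS]mxE -addrA.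
congr (_ + _); apply: fpsP => l; rewrite fps_coefD !fps_coefXM.
by case: l => [|[|l]]; case: (i == j); rewrite /= ?mulr0n ?addr0.
Qed.

Lemma even_mxS r : even_mx r = even_mx r.+1 + (fpsX U)%:M.
Proof.
rewrite -one_plus_tD; congr (one_plus_t (_ + 1%:M)).
by rewrite -[r.+2]addn1 natrD raddfD opprD addrA subrK.
Qed.

Lemma odd_mxS r : odd_mx r.+1 = odd_mx r + (fpsX U)%:M.
Proof. by rewrite -one_plus_tD -addrA /odd_mx -[r.+2]addn1 natrD raddfD. Qed.

Lemma even_mx_commutator r x y z t
    (S := fun i j => even_mx r (lshift n i) (lshift n j)) :
  S x y * S z t = S z t * S x y
    + fpsX U * (S x t *+ (y == z) - S z y *+ (x == t)).
Proof.
have par (l : 'I_m) : gl_parity (lshift n l) = false.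
  by rewrite /gl_parity /= leqNgt ltn_ord.
have cS := covariant_one_plus_t (covariant_shift r.+1 1 (@Ehat_covariant K m n)).
have := one_plus_t_commutator r.+1 1 (lshift n x) (lshift n y) cS (par z) (par t).
by rewrite mul1r !(inj_eq (@lshift_inj _ _)).
Qed.

(** This is [inverse_relation] with T = t, applied to the inverses of two consecutive matrices,
    which differ by the scalar t. Odd parity supplies the minus sign in its commutation
    hypothesis. *)
Lemma odd_mx_commutator r x y z t
    (Z := fun r i j => odd_inv r (rshift m i) (rshift m j)) :
  Z r.+1 x y * Z r z t = Z r z t * Z r.+1 x y
    + (Z r.+1 z y * Z r x t - Z r z y * Z r.+1 x t).
Proof.
have par (l : 'I_n) : gl_parity (rshift m l) = true.
  by rewrite /gl_parity /= leq_addr.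
have [TZW TWZ] := inverse_shift (@fpsX_comm U) (mx_inv_one_plus_t _)
  (mx_inv_one_plus_t _) (odd_mxS r).
rewrite {}/Z /odd_inv; apply: (@inverse_relation _ _ (@fpsX_comm U) _ (odd_mx r)
  _ _ _ _ _ _ (mx_inv_one_plus_t _) TZW TWZ) => e f.
have cW := covariant_inv (covariant_shift m r.+2 (@Ehat_covariant K m n)).
have := one_plus_t_commutator m r.+1 e f cW (par x) (par y).
by rewrite expr1 mulN1r.
Qed.

Lemma rtt_odd : rtt odd_block.
Proof.
move=> r a b c d; have := odd_mx_commutator r d b c a.
(* Generalizing the matrices keeps unification from unfolding them. *)
have E := odd_blockE; move: odd_block odd_inv E => X Z XE; rewrite !XE => -> /=.
by rewrite -addrA [_ - _ - _]addrAC subrr add0r.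
Qed.

(** After substituting X_{r+1} = X_r - t, the relation reduces to the commutator of X_r(a,c) and
    X_r(b,d). *)
Lemma rtt_even : rtt even_block.
Proof.
move=> r a b c d; have E := even_blockE.
have comm := even_mx_commutator r; have shift := even_mxS r.
move: even_block even_mx E comm shift => X S XE SS shift; rewrite !XE.
have S' x y : S r.+1 (lshift n x) (lshift n y)
    = S r (lshift n x) (lshift n y) - fpsX U *+ (x == y).
  by rewrite shift !mxE (inj_eq (@lshift_inj _ _)) addrK.
rewrite !S' !mulrBr !mulrBl SS !opprB !(mulrnAl, mulrnAr) -!fpsX_comm mulrBr.
rewrite !(mulrnAl, mulrnAr) addrAC -!addrA [c == b]eq_sym; congr (_ + _).
by rewrite addKr addrA [RHS]addrC.
Qed.

End Decomposition.

(** * Linear systems solved by quasideterminants *)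

Section QuasideterminantVectors.
Variables (B : unitRingType) (N : nat) (M : 'M[B]_N) (J : 'I_N).
Hypothesis qdef : quasidet_defined (leading_mx M J) ord_max ord_max.
Let L := leading_mx M J.
Let V := mx_inv L.
Let w := widen_ord (ltn_ord J).

Let LV : mx_inverse L V.
Proof. by have [[Y LY] _] := qdef; rewrite /V (mx_invE LY). Qed.

Let VU : V ord_max ord_max \is a GRing.unit.
Proof. by have [_] := qdef. Qed.

Let wM : w ord_max = J. Proof. exact: val_inj. Qed.

Lemma quasidet_column : exists u : 'I_N -> B, u J = 1 /\ forall k : 'I_N,
  (k <= J)%N -> \sum_(j < N | (j <= J)%N) M k j * u j
              = quasidet (leading_mx M J) ord_max ord_max *+ (k == J).
Proof.
pose q := quasidet (leading_mx M J) ord_max ord_max.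
(* The last column of the inverse, normalized to 1 at [J]. Beyond the block [inord] takes a default
   value, which the sum over j <= J never meets. *)
exists (fun j => V (inord j) ord_max * q); split.
  have -> : inord J = ord_max :> 'I_J.+1 by apply: val_inj; rewrite /= inordK.
  exact: mulrV.
move=> k kJ; pose k' : 'I_J.+1 := inord k.
have kE : k = w k' by apply: val_inj; rewrite /= inordK.
have -> : (k == J) = (k' == ord_max).
  by transitivity (w k' == w ord_max); first by rewrite wM -kE.
rewrite (eq_bigl (fun j : 'I_N => (j < J.+1)%N)) // (big_ord_narrow (ltn_ord J)) /=.
have /matrixP/(_ k' ord_max) := LV.2; rewrite !mxE => LVE.
rewrite -/q -mulr_natl -LVE mulr_suml; apply: eq_bigr => j _.
by rewrite inord_val mulrA [L _ _]mxE kE.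
Qed.

(* x is row J of the inverse of the leading block times the first J + 1 rows of
   M; it replaces the Schur complement formula. *)
Lemma quasidet_row Z : mx_inverse M Z ->
  exists x : 'I_N -> B, x J = 1 /\ forall l : 'I_N,
  (J <= l)%N -> \sum_(k < N | (J <= k)%N) x k * Z k l
              = (quasidet (leading_mx M J) ord_max ord_max)^-1 *+ (l == J).
Proof.
move=> [_ MZ]; pose x k := \sum_i V ord_max i * M (w i) k.
have xw i : x (w i) = (i == ord_max)%:R.
  have /matrixP/(_ ord_max i) := LV.1; rewrite !mxE eq_sym => <-.
  by apply: eq_bigr => j _; rewrite [L _ _]mxE.
exists x; split=> [|l Jl].
  by transitivity (x (w ord_max)); [rewrite wM | rewrite xw eqxx].
transitivity (\sum_k x k * Z k l).
  rewrite [RHS](bigID (fun k : 'I_N => (J <= k)%N)) /= [X in _ = _ + X]big1 ?addr0 //.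
  move=> k; rewrite -ltnNge => kJ.
  have kE : k = w (inord k) by apply: val_inj; rewrite /= inordK // ltnW.
  have kM : inord k != ord_max :> 'I_J.+1.
    by apply: contraTneq kJ => /(congr1 w); rewrite -kE wM => ->; rewrite ltnn.
  by rewrite kE xw (negPf kM) mul0r.
rewrite /x; under eq_bigr do rewrite mulr_suml.
rewrite exchange_big /=.
transitivity (\sum_i V ord_max i *+ (w i == l)).
  apply: eq_bigr => i _; rewrite -[RHS]mulr_natr.
  have /matrixP/(_ (w i) l) := MZ; rewrite !mxE => <-.
  by rewrite mulr_sumr; apply: eq_bigr => k _; rewrite mulrA.
rewrite /quasidet invrK -/L -/V.
have [lJ|lJ] := eqVneq l J.
  rewrite -[RHS](sumr_mulrb_eq (ord_max : 'I_J.+1) (V ord_max)).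
  apply: eq_bigr => i _; congr (_ *+ _); rewrite eq_sym lJ.
  by transitivity (w ord_max == w i); first by rewrite wM.
rewrite big1 // => i _; case: eqP => // wl; case/eqP: lJ; apply/val_inj/eqP.
by rewrite eqn_leq Jl -wl /= -ltnS ltn_ord.
Qed.

End QuasideterminantVectors.

(** * Factorization of the Berezinian *)

Section Decomposition.
Variables (K : fieldType) (m n : nat).

Lemma berezinian_decomposition : berezinian K m n =
  (\prod_(a < m) even_factor K n a) * (\prod_(b < n) odd_factor K m b).
Proof.
rewrite berezinianE; congr (_ * _).
  apply: cdet_factor_last (@rtt_even K m n) _ => a.
  have qd := quasidet_one_plus_t
    (leading_mx (Ehat K m n) (lshift n a) - a.+1%:R%:M + 1%:R%:M) ord_max.
  rewrite one_plus_t_leading in qd.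
  have [u [uJ uP]] := quasidet_column qd.
  exists (u \o lshift n); split=> // k ka.
  have := uP (lshift n k) ka; rewrite (inj_eq (@lshift_inj _ _)).
  (* Odd indices lie beyond the leading block, so the sum stays in the even block. *)
  rewrite -one_plus_t_leading big_split_ord /= [X in _ + X]big1 ?addr0; last first.
    by move=> j; rewrite leqNgt ltn_addr.
  move=> uE; rewrite -[RHS]uE; apply: eq_bigr => j _.
  by rewrite even_blockE.
apply: cdet_factor_first (@rtt_odd K m n) _ => b.
have qd := quasidet_one_plus_t
  (leading_mx (Ehat K m n) (rshift m b) - m%:R%:M + b.+1%:R%:M) ord_max.
rewrite one_plus_t_leading in qd.
have [x [xJ xP]] := quasidet_row qd (mx_inv_one_plus_t _).
exists (x \o @rshift m n); split=> // l bl.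
have := xP (rshift m l); rewrite leq_add2l => /(_ bl).
(* Even indices precede [J], so only the odd block of the full inverse contributes. *)
rewrite (inj_eq (@rshift_inj _ _)) -one_plus_t_leading big_split_ord /= big1; last first.
  by move=> j; rewrite leqNgt ltn_addr.
rewrite add0r => xE; rewrite -[RHS]xE; apply: eq_big => j.
  by rewrite leq_add2l.
by rewrite odd_blockE.
Qed.

End Decomposition.

Theorem theorem3p1 (R : realType) (m n : nat) :
  (0 < m)%N -> (0 < n)%N ->
  berezinian R[i] m n =
    (\prod_(a < m) even_factor R[i] n a) * (\prod_(b < n) odd_factor R[i] m b)
  /\ (forall i j : 'I_(m + n),
        gauss_factor R[i] i * gauss_factor R[i] j =
        gauss_factor R[i] j * gauss_factor R[i] i).
Proof.
move=> _ _; split=> [|i j]; first exact: berezinian_decomposition.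
exact: gauss_factor_comm.
Qed.
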